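(* Let $\mathbf{c}_0\in\mathbb{N}^n$ be an initial configuration on the directed path $P_n$. If the first $\lceil\frac{n+1}{2}\rceil$ positions of $\mathbf{c}_0$ are all non-zero, then $\mathcal{A}(P_n,\mathbf{c}_0)$ is contractible.
   Context: $P_n$ is the directed path with vertices $v_1,\dots,v_{n+1}$ and edges $(v_i,v_{i+1})$ for $i=1,\dots,n$. The vertex $v_{n+1}$ is a sink: it never fires, absorbs grains, and is not included in configurations or in the avalanche complex. A configuration is a vector $\mathbf{c}\in\mathbb{N}^n$ ($0\in\mathbb{N}$), where $\mathbf{c}(v_i)$ is the number of grains on $v_i$, $1\le i\le n$. Parallel-firing sandpile dynamics started from $\mathbf{c}_0$: at each time $t=0,1,2,\dots$ the firing set $\sigma_t$ is the set of $v_i$, $1\le i\le n$, with $\mathbf{c}_t(v_i)\ge 1$; all of these fire simultaneously, each sending one grain to $v_{i+1}$, so that $\mathbf{c}_{t+1}(v_i)=\mathbf{c}_t(v_i)-[v_i\in\sigma_t]+[v_{i-1}\in\sigma_t]$ for $1\le i\le n$ (where $[\cdot]$ is $1$ if the condition holds and $0$ otherwise, and the last term is $0$ for $i=1$). The avalanche complex $\mathcal{A}(P_n,\mathbf{c}_0)$ is the simplicial complex generated by the firing sets, i.e. the simplices are all nonempty subsets of the sets $\sigma_t$, $t\ge 0$ (vertices that never fire are not vertices of the complex). *)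

(* Defs.v *)
From HB Require Import structures.
From mathcomp Require Import all_boot all_order all_algebra.
From mathcomp Require Import all_classical all_reals all_analysis.

Set Implicit Arguments.
Unset Strict Implicit.
Unset Printing Implicit Defensive.

Import Order.TTheory GRing.Theory Num.Theory.
Import numFieldNormedType.Exports.

Local Open Scope classical_set_scope.
Local Open Scope ring_scope.

(* [V] is only the ambient set of labels: the vertices of [K] are the [v] such
   that [[set v]] is a simplex, and the empty set is never a simplex. *)
Record simplicial_complex (V : finType) := SimplicialComplex {
  simplices : set {set V};
  simplex_neq0 : forall A : {set V}, simplices A -> A != finset.set0;
  simplex_sub : forall A B : {set V},
    simplices A -> B \subset A -> B != finset.set0 -> simplices B }.

Section Generated.
Variables (V : finType) (F : set {set V}).

Definition generated_simplices : set {set V} :=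
  [set A : {set V} | A != finset.set0 /\ exists2 S, F S & A \subset S].

Lemma generated_neq0 (A : {set V}) :
  generated_simplices A -> A != finset.set0.
Proof. by case. Qed.

Lemma generated_sub (A B : {set V}) : generated_simplices A ->
  B \subset A -> B != finset.set0 -> generated_simplices B.
Proof.
by move=> [_ [S FS AS]] BA B0; split=> //; exists S => //; exact: fintype.subset_trans BA AS.
Qed.

Definition generated_complex : simplicial_complex V :=
  SimplicialComplex generated_neq0 generated_sub.
End Generated.

(* Barycentric coordinates; the complex being finite, the topology of its
   realization is the one induced by [R^n]. *)
Definition realization (R : realType) (n : nat) (K : simplicial_complex 'I_n) :
    set 'rV[R]_n :=
  [set x | [/\ forall i, 0 <= x 0 i, \sum_i x 0 i = 1 &
               simplices K (finset (fun i => x 0 i != 0))]].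
Arguments realization R {n} K.

(* The subspace [A] of [T] is contractible: its identity map is homotopic,
   within [A], to a constant map. *)
Definition contractible (R : realType) (T : topologicalType) (A : set T) : Prop :=
  exists2 a, A a & exists H : T * R -> T,
    [/\ {within A `*` `[0, 1], continuous H},
        forall x t, A x -> t \in `[0, 1] -> A (H (x, t)),
        forall x, A x -> H (x, 0) = x &
        forall x, A x -> H (x, 1) = a].

(* [i : 'I_n] stands for the path vertex [v_(i+1)]; the sink is left out. *)
Definition configuration (n : nat) := {ffun 'I_n -> nat}.

Definition firing_set (n : nat) (c : configuration n) : {set 'I_n} :=
  finset (fun i => (0 < c i)%N).

Definition fire (n : nat) (c : configuration n) : configuration n :=
  [ffun i : 'I_n => (c i - (i \in firing_set c)
     + [exists j : 'I_n, (j.+1 == i :> nat) && (j \in firing_set c)])%N].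

Definition config_at (n : nat) (c0 : configuration n) (t : nat) :
  configuration n := iter t (@fire n) c0.

Definition avalanche_complex (n : nat) (c0 : configuration n) :
    simplicial_complex 'I_n :=
  generated_complex (range (fun t => firing_set (config_at c0 t))).

(* Main.v *)
Require Import Defs.
From mathcomp Require Import all_boot all_order all_algebra.
From mathcomp Require Import all_classical all_reals all_analysis.
Import numFieldNormedType.Exports.
From mathcomp Require Import zify.

(** The avalanche complex is a cone, and a cone retracts onto its apex along
straight lines ([contractible_cone]).

Number the vertices from [0] and let [m = uphalf n.+1], so that
[n <= 2 * m - 1].  The apex is the last vertex [m.-1] of the part that is
known to be loaded.  A vertex holds a grain as soon as its predecessor has
just fired, so the loaded stretch [0 .. m-1] moves one step per unit of time:
at time [t] every vertex in positions [t .. m+t-1] fires ([firing_window]).  In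
particular the apex fires at all times [t < m].

In the same way, below position [m + t] the firing set at time [t] is closed
under passing to the next vertex ([firing_upclosed]).  Once [n <= m + t], which
holds from time [m.-1] on, it is closed on the whole path, so no vertex can be
revived, and the firing sets decrease from then on ([firing_decreasing]).
Hence every firing set lies in one that contains the apex
([firing_sets_have_apex]), which is what makes the complex a cone. *)

Set Implicit Arguments.
Unset Strict Implicit.
Unset Printing Implicit Defensive.

Import Order.TTheory GRing.Theory Num.Theory.

(** * Cones are contractible *)

Section Cone.
Local Open Scope classical_set_scope.
Local Open Scope ring_scope.

Definition is_cone (V : finType) (K : simplicial_complex V) (v : V) : Prop :=
  simplices K (finset.set1 v) /\
  forall A, simplices K A -> simplices K (finset.setU (finset.set1 v) A).

Lemma generated_is_cone (V : finType) (F : set {set V}) (v : V) :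
  F !=set0 -> (forall S, F S -> exists2 S', F S' & S \subset S' /\ v \in S') ->
  is_cone (generated_complex F) v.
Proof.
move=> [S0 FS0] FP; split.
  have [S FS [_ vS]] := FP _ FS0.
  split; last by exists S => //; rewrite finset.sub1set.
  by apply/set0Pn; exists v; rewrite finset.in_set1.
move=> A [_ [S /FP [S' FS' [SS' vS']] AS]]; split.
  by apply/set0Pn; exists v; rewrite finset.setU11.
exists S' => //; rewrite finset.subUset finset.sub1set vS' /=.
exact: fintype.subset_trans AS SS'.
Qed.

Lemma sub_simplex_realization (R : realType) (n : nat)
    (K : simplicial_complex 'I_n) (A : {set 'I_n}) (x : 'rV[R]_n) :
  simplices K A -> (forall i, 0 <= x 0 i) -> \sum_i x 0 i = 1 ->
  (forall i, i \notin A -> x 0 i = 0) -> realization R K x.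
Proof.
move=> KA x_ge0 x_sum x_out; split=> //; apply: simplex_sub KA _ _.
  apply/fintype.subsetP => i; rewrite finset.inE.
  by apply: contra_neqT => /x_out.
(* the coordinates cannot all vanish, since they add up to 1 *)
apply/eqP => supp0; have := oner_neq0 R; rewrite -x_sum big1 ?eqxx// => i _.
have : i \notin finset (fun i => x 0 i != 0) by rewrite supp0 finset.in_set0.
by rewrite finset.inE negbK => /eqP.
Qed.

Definition cone_homotopy (R : realType) (n : nat) (v : 'I_n)
    (p : 'rV[R]_n * R) : 'rV[R]_n :=
  (1 - p.2) *: p.1 + p.2 *: delta_mx 0 v.

Lemma continuous_cone_homotopy (R : realType) (n : nat) (v : 'I_n) :
  continuous (@cone_homotopy R n v).
Proof.
move=> p; apply: cvgD; apply: cvgZ.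
- by apply: cvgB; [exact: cvg_cst|exact: cvg_snd].
- exact: cvg_fst.
- exact: cvg_snd.
- exact: cvg_cst.
Qed.

(** The support of a point on the segment from [x] to the apex is contained in
the support of [x] with the apex added, hence stays a simplex of the cone. *)
Lemma cone_homotopy_realization (R : realType) (n : nat)
    (K : simplicial_complex 'I_n) (v : 'I_n) (x : 'rV[R]_n) (t : R) :
  is_cone K v -> 0 <= t <= 1 -> realization R K x ->
  realization R K (cone_homotopy v (x, t)).
Proof.
move=> [_ Kv] /andP[t0 t1] [x_ge0 x_sum Kx].
apply: sub_simplex_realization (Kv _ Kx) _ _ _.
- move=> i; rewrite !mxE eqxx /=.
  by rewrite addr_ge0// mulr_ge0// subr_ge0.
- under eq_bigr do rewrite !mxE eqxx /=.
  rewrite big_split/= -!mulr_sumr x_sum (bigD1 v)//= eqxx big1.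
    by rewrite addr0 !mulr1 subrK.
  by move=> i /negbTE ->.
- move=> i; rewrite !finset.inE negb_or negbK !mxE eqxx /=.
  by move=> /andP[/negbTE -> /eqP ->]; rewrite !mulr0 addr0.
Qed.

Lemma contractible_cone (R : realType) (n : nat) (K : simplicial_complex 'I_n)
    (v : 'I_n) :
  is_cone K v -> contractible R (realization R K).
Proof.
move=> Kv; exists (delta_mx 0 v).
  apply: sub_simplex_realization Kv.1 _ _ _.
  - by move=> i; rewrite mxE ler0n.
  - rewrite (bigD1 v)//= mxE !eqxx big1 ?addr0// => i /negbTE iv.
    by rewrite mxE iv andbF.
  - by move=> i; rewrite finset.inE => /negbTE iv; rewrite mxE iv andbF.
exists (cone_homotopy v); split.
- exact/continuous_subspaceT/continuous_cone_homotopy.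
- move=> x t Kx; rewrite in_itv /= => t01.
  exact: cone_homotopy_realization.
- by move=> x _; rewrite /cone_homotopy /= subr0 scale1r scale0r addr0.
- by move=> x _; rewrite /cone_homotopy /= subrr scale1r scale0r add0r.
Qed.
End Cone.

(** * Firing sets on the directed path *)

Lemma fire_next (n : nat) (c : configuration n) (i j : 'I_n) :
  j = i.+1 :> nat -> i \in firing_set c -> j \in firing_set (fire c).
Proof.
move=> ji ic; rewrite finset.inE ffunE.
suff -> : [exists k : 'I_n, (k.+1 == j :> nat) && (k \in firing_set c)].
  by rewrite addn1.
by apply/existsP; exists i; rewrite ji eqxx.
Qed.

Lemma fire_inv (n : nat) (c : configuration n) (j : 'I_n) :
  j \in firing_set (fire c) ->
  j \in firing_set c \/ exists2 i : 'I_n, j = i.+1 :> nat & i \in firing_set c.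
Proof.
move=> jc; have : 0 < fire c j by move: jc; rewrite finset.inE.
rewrite ffunE; case: existsP => [[i /andP[/eqP ij ic]] _|_].
  by right; exists i.
by rewrite addn0 => cj; left; rewrite finset.inE; lia.
Qed.

Section LoadedPrefix.
Variables (n m : nat) (c0 : configuration n).
Hypothesis c0_gt0 : forall i : 'I_n, i < m -> 0 < c0 i.

Let sigma (t : nat) : {set 'I_n} := firing_set (config_at c0 t).

Lemma firing_window (t : nat) (i : 'I_n) : t <= i < m + t -> i \in sigma t.
Proof.
elim: t i => [|t IHt] i ti; first by rewrite finset.inE c0_gt0; lia.
have i'n : i.-1 < n by have := ltn_ord i; lia.
by apply: (@fire_next _ _ (Ordinal i'n)) => /=; [|apply: IHt => /=]; lia.
Qed.

(** Closure is inherited from time [t] by time [t.+1]: a vertex firing at time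
[t.+1] either fired at time [t] or has just received a grain from its
predecessor, in which case it also fired at time [t], by closure.  So its
successor has received a grain. *)
Lemma firing_upclosed (t : nat) (i j : 'I_n) :
  j = i.+1 :> nat -> j < m + t -> i \in sigma t -> j \in sigma t.
Proof.
elim: t i j => [|t IHt] i j ji jm.
  by move=> _; rewrite finset.inE; apply: c0_gt0; lia.
move=> it1; apply: (fire_next ji).
have [//|[k ik kt]] := fire_inv it1.
by apply: IHt ik _ kt; lia.
Qed.

(** From time [s] on closure holds on the whole path, so a vertex that receives
a grain was already firing. *)
Lemma firing_decreasing (s t : nat) :
  n <= m + s -> s <= t -> sigma t \subset sigma s.
Proof.
move=> nms; elim: t => [|t IHt].
  by rewrite leqn0 => /eqP ->.
rewrite leq_eqVlt => /predU1P[-> //|st].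
apply: fintype.subset_trans (IHt st); apply/fintype.subsetP => j.
move=> /fire_inv[//|[i ji it]].
by apply: firing_upclosed ji _ it; have := ltn_ord j; lia.
Qed.

(** Times up to [v] see the apex [v] in the moving window; the firing sets at
later times lie in the one at time [v]. *)
Lemma firing_sets_have_apex (v : 'I_n) (t : nat) :
  m = v.+1 -> n <= m + v ->
  exists t', sigma t \subset sigma t' /\ v \in sigma t'.
Proof.
move=> mv nmv; have [tv|/ltnW vt] := leqP t v.
  by exists t; split=> //; apply: firing_window; lia.
exists v; split; first exact: firing_decreasing.
by apply: firing_window; lia.
Qed.
End LoadedPrefix.

Theorem lemma3p5 (R : realType) (n : nat) (n_gt0 : (0 < n)%N)
    (c0 : configuration n)
    (c0_neq0 : forall i : 'I_n, (i < uphalf n.+1)%N -> c0 i <> 0%N) :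
  contractible R (realization R (avalanche_complex c0)).
Proof.
have c0_gt0 (i : 'I_n) : i < uphalf n.+1 -> 0 < c0 i.
  by move=> /c0_neq0/eqP; rewrite lt0n.
(* the last loaded vertex; it exists as [0 < uphalf n.+1 <= n] *)
have vn : (uphalf n.+1).-1 < n by lia.
apply: (@contractible_cone _ _ _ (Ordinal vn)); apply: generated_is_cone.
  by exists (firing_set c0), 0.
move=> _ [t _ <-].
have [|/=|t' [tt' vt']] := firing_sets_have_apex c0_gt0 (v := Ordinal vn) t.
- by rewrite /=; lia.
- by lia.
by exists (firing_set (config_at c0 t')) => //; exists t'.
Qed.
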